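(* Let $Q$ be a right rooted quiver. Then $Q$ is a source injective representation quiver. That is, for every ring $R$ and every representation $\mathcal{X}\in(Q,R\text{-Mod})$, $\mathcal{X}$ is an injective object of $(Q,R\text{-Mod})$ if and only if (i) $\mathcal{X}(v)$ is an injective left $R$-module for every vertex $v$ of $Q$, and (ii) for every vertex $v$ the morphism $\mathcal{X}(v)\to\prod_{s(a)=v}\mathcal{X}(t(a))$ induced by the maps $\mathcal{X}(a):\mathcal{X}(v)\to\mathcal{X}(t(a))$ is a splitting epimorphism.
   Context: Rings are associative with identity, not necessarily commutative. A quiver $Q$ consists of a set $V$ of vertices, a set $\Gamma$ of arrows and source and target maps $s,t:\Gamma\to V$; both sets may be infinite, and loops and multiple arrows are allowed. $(Q,R\text{-Mod})$ is the category of representations of $Q$ by left $R$-modules: a representation $\mathcal{X}$ assigns a left $R$-module $\mathcal{X}(v)$ to each vertex $v$ and a homomorphism $\mathcal{X}(a):\mathcal{X}(s(a))\to\mathcal{X}(t(a))$ to each arrow $a$; morphisms are natural transformations. A quiver $Q$ is right rooted if there is no path of the form $\bullet\to\bullet\to\bullet\to\cdots$ in $Q$, i.e. no infinite sequence of arrows $a_1,a_2,a_3,\dots$ (repetitions allowed) with $t(a_i)=s(a_{i+1})$ for all $i\ge1$. The product in (ii) is over all arrows $a$ with $s(a)=v$. *)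

(* Defs.v *)
From HB Require Import structures.
From mathcomp Require Import all_boot all_algebra.
From mathcomp Require Import boolp.

Set Implicit Arguments.
Unset Strict Implicit.
Unset Printing Implicit Defensive.

Import GRing.Theory.
Local Open Scope ring_scope.

Record quiver := Quiver {
  vertex : Type;
  arrow : Type;
  src : arrow -> vertex;
  tgt : arrow -> vertex
}.

Definition right_rooted (Q : quiver) : Prop :=
  ~ exists a : nat -> arrow Q, forall i, tgt (a i) = src (a i.+1).

(* Rings are [pzRingType]s, so that the zero ring is allowed. *)

(* MathComp only has the module structure on non-dependent functions [T -> M];
   this is the product of a family of modules that varies with the index. *)
Section ProductModule.
Variables (R : pzRingType) (I : Type) (M : I -> lmodType R).

Definition prod_module : Type := forall i, M i.

HB.instance Definition _ := gen_eqMixin prod_module.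
HB.instance Definition _ := gen_choiceMixin prod_module.

Implicit Types f g h : prod_module.

Definition prodm_zero : prod_module := fun i => 0.
Definition prodm_opp f : prod_module := fun i => - f i.
Definition prodm_add f g : prod_module := fun i => f i + g i.
Definition prodm_scale (c : R) f : prod_module := fun i => c *: f i.

Lemma prodm_addA : associative prodm_add.
Proof. by move=> f g h; apply: functional_extensionality_dep => i; exact: addrA. Qed.

Lemma prodm_addC : commutative prodm_add.
Proof. by move=> f g; apply: functional_extensionality_dep => i; exact: addrC. Qed.

Lemma prodm_add0 : left_id prodm_zero prodm_add.
Proof. by move=> f; apply: functional_extensionality_dep => i; exact: add0r. Qed.

Lemma prodm_addN : left_inverse prodm_zero prodm_opp prodm_add.
Proof. by move=> f; apply: functional_extensionality_dep => i; exact: addNr. Qed.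

HB.instance Definition _ := GRing.isZmodule.Build prod_module
  prodm_addA prodm_addC prodm_add0 prodm_addN.

Lemma prodm_scaleA a b f :
  prodm_scale a (prodm_scale b f) = prodm_scale (a * b) f.
Proof. by apply: functional_extensionality_dep => i; exact: scalerA. Qed.

Lemma prodm_scale1 : left_id 1 prodm_scale.
Proof. by move=> f; apply: functional_extensionality_dep => i; exact: scale1r. Qed.

Lemma prodm_scaleDr : right_distributive prodm_scale +%R.
Proof. by move=> a f g; apply: functional_extensionality_dep => i; exact: scalerDr. Qed.

Lemma prodm_scaleDl f : {morph prodm_scale^~ f : a b / a + b}.
Proof. by move=> a b; apply: functional_extensionality_dep => i; exact: scalerDl. Qed.

HB.instance Definition _ := GRing.Zmodule_isLmodule.Build R prod_module
  prodm_scaleA prodm_scale1 prodm_scaleDr prodm_scaleDl.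

Variables (N : lmodType R) (p : forall i, {linear N -> M i}).

Definition prodm_map (x : N) : prod_module := fun i => p i x.

Lemma prodm_map_is_linear : linear prodm_map.
Proof. by move=> a x y; apply: functional_extensionality_dep => i; exact: linearP. Qed.

HB.instance Definition _ := GRing.isLinear.Build R N prod_module *:%R
  prodm_map prodm_map_is_linear.

End ProductModule.

Definition injective_module (R : pzRingType) (E : lmodType R) : Prop :=
  forall (A B : lmodType R) (i : {linear A -> B}) (f : {linear A -> E}),
    injective i -> exists g : {linear B -> E}, g \o i =1 f.

Definition split_epi (R : pzRingType) (A B : lmodType R) (p : {linear A -> B}) :
    Prop :=
  exists s : {linear B -> A}, p \o s =1 id.

Section Representations.
Variables (Q : quiver) (R : pzRingType).

Record representation := Representation {
  rep_obj :> vertex Q -> lmodType R;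
  rep_map : forall a : arrow Q, {linear rep_obj (src a) -> rep_obj (tgt a)}
}.

Record rep_hom (X Y : representation) := RepHom {
  rep_hom_fun :> forall v, {linear X v -> Y v};
  rep_hom_natural : forall a : arrow Q,
    rep_hom_fun (tgt a) \o rep_map X a =1 rep_map Y a \o rep_hom_fun (src a)
}.

Definition rep_hom_eq (X Y : representation) (f g : rep_hom X Y) : Prop :=
  forall v, f v =1 g v.

Lemma rep_comp_natural (X Y Z : representation)
    (g : rep_hom Y Z) (f : rep_hom X Y) (a : arrow Q) :
  (g (tgt a) \o f (tgt a)) \o rep_map X a
    =1 rep_map Z a \o (g (src a) \o f (src a)).
Proof.
move=> x /=.
by move: (@rep_hom_natural _ _ f a x) (@rep_hom_natural _ _ g a (f _ x)) => /= -> ->.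
Qed.

Definition rep_comp (X Y Z : representation) (g : rep_hom Y Z) (f : rep_hom X Y) :
    rep_hom X Z :=
  @RepHom X Z (fun v => g v \o f v : {linear X v -> Z v}) (rep_comp_natural g f).

Definition rep_mono (A B : representation) (i : rep_hom A B) : Prop :=
  forall (Z : representation) (g h : rep_hom Z A),
    rep_hom_eq (rep_comp i g) (rep_comp i h) -> rep_hom_eq g h.

Definition injective_rep (X : representation) : Prop :=
  forall (A B : representation) (i : rep_hom A B) (f : rep_hom A X),
    rep_mono i -> exists g : rep_hom B X, rep_hom_eq (rep_comp g i) f.

Definition out_arrow (v : vertex Q) : Type := {a : arrow Q | src a = v}.

(* [rep_map X a], with its domain [X (src a)] transported to [X v]. *)
Definition out_map (X : representation) (v : vertex Q) (a : out_arrow v) :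
    {linear X v -> X (tgt (sval a))} :=
  eq_rect (src (sval a)) (fun w => {linear X w -> X (tgt (sval a))})
    (rep_map X (sval a)) v (svalP a).

Definition source_map (X : representation) (v : vertex Q) :
    {linear X v -> prod_module (fun a : out_arrow v => X (tgt (sval a)))} :=
  prodm_map (@out_map X v).

End Representations.

Definition source_injective_representation_quiver (Q : quiver) : Prop :=
  forall (R : pzRingType) (X : representation Q R),
    injective_rep X <->
    (forall v : vertex Q, injective_module (X v)) /\
    (forall v : vertex Q, split_epi (source_map X v)).

(* Main.v *)
Require Import Defs.
From HB Require Import structures.
From mathcomp Require Import all_boot all_algebra.
From mathcomp Require Import boolp.

(** In a right rooted quiver one can argue by induction along the arrows, the
    targets of the arrows leaving v coming before v ([right_rooted_wf]).

    Suppose every X(v) is injective and every source map p_v has a linear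
    section s_v.  A morphism f : A -> X is extended along a monomorphism
    i : A -> B vertex by vertex, the targets of the arrows leaving v before v
    itself.  The extensions g chosen at these targets prescribe the composite of
    g_v with p_v: it has to be h = (g_(t a) o B(a))_a.  Any module extension e of
    f_v to B(v) can be corrected to e + s_v (h - p_v e), which has this composite;
    the correction vanishes on A(v), because there h and p_v e agree by
    naturality of f ([injective_rep_of_split]).

    Conversely, let X be injective.  The representation
    Y(v) = X(v) x prod_a X(t a), with Y(a)(x, y) = (y_a, p y_a), contains X via
    x |-> (x, p x), so X is a retract of Y.  If r : Y -> X is a retraction, then
    y |-> r_v (0, y) is a section of p_v, since naturality gives
    X(a) (r_v (0, y)) = r (y_a, p y_a) = y_a ([split_epi_source_map]).

    Homomorphisms into ker p_v extend along injections, because a morphism to X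
    from a representation all of whose arrows act by zero is the same as a
    family of homomorphisms into the kernels of the source maps
    ([extend_into_source_kernel]).  As p_v splits, X(v) is ker p_v plus the
    product of the X(t a), so well-founded induction on v shows that it is
    injective ([injective_vertex]). *)

Set Implicit Arguments.
Unset Strict Implicit.
Unset Printing Implicit Defensive.

Import GRing.Theory.
Local Open Scope ring_scope.

Local Arguments rep_hom_natural {Q R X Y} r a x : rename.

(** * Well-foundedness of right rooted quivers *)

Section WellFounded.
Variable Q : quiver.

Definition successor (w v : vertex Q) : Prop :=
  exists a : arrow Q, src a = v /\ tgt a = w.

Lemma successor_out (v : vertex Q) (a : out_arrow v) :
  successor (tgt (sval a)) v.
Proof. by exists (sval a); split=> //; exact: svalP a. Qed.

(** A vertex that is not accessible has an arrow to another such vertex, and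
    iterating a choice of these arrows produces an infinite path. *)
Lemma right_rooted_wf : right_rooted Q -> well_founded successor.
Proof.
move=> hQ v; apply: contrapT => nAv; apply: hQ.
have step (u : {u | ~ Acc successor u}) :
    {a : arrow Q | src a = sval u /\ ~ Acc successor (tgt a)}.
  apply: cid; case: u => u nAu /=; apply: contrapT => none.
  apply: nAu; constructor=> w [a [sa ta]]; subst w.
  by apply: contrapT => nAw; apply: none; exists a.
pose next u : {u | ~ Acc successor u} :=
  exist _ (tgt (sval (step u))) (svalP (step u)).2.
pose u n := iter n next (exist _ v nAv).
exists (fun n => sval (step (u n))) => n.
by rewrite (svalP (step (u n.+1))).1.
Qed.

End WellFounded.

(** * Monomorphisms of representations *)

Section Kernel.
Variables (R : pzRingType) (M N : lmodType R) (f : {linear M -> N}).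

Definition kernel_pred : {pred M} := [pred x | f x == 0].

Lemma kernel_submod_closed : submod_closed kernel_pred.
Proof.
split=> [|c x y]; rewrite !inE ?linear0 // => /eqP fx0 /eqP fy0.
by rewrite linearP fx0 fy0 scaler0 addr0.
Qed.

HB.instance Definition _ :=
  GRing.isSubmodClosed.Build R M kernel_pred kernel_submod_closed.

Definition kernel : Type := {x : M | x \in kernel_pred}.

HB.instance Definition _ := SubChoice.on kernel.
HB.instance Definition _ :=
  [SubChoice_isSubLmodule of kernel by <:].

Lemma kernelP (x : kernel) : f (val x) = 0.
Proof. exact/eqP/(valP x). Qed.

End Kernel.

Section Representations.
Variables (Q : quiver) (R : pzRingType).
Implicit Types (X A B : representation Q R) (v w : vertex Q).

Local Notation out_product X v :=
  (prod_module (fun a : out_arrow v => X (tgt (sval a)))).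

Section KernelRepresentation.
Variables (A B : representation Q R) (i : rep_hom A B).

Lemma kernel_map_subproof (a : arrow Q) (x : kernel (i (src a))) :
  rep_map A a (val x) \in kernel_pred (i (tgt a)).
Proof.
by rewrite inE; have /= -> := rep_hom_natural i a (val x); rewrite kernelP linear0.
Qed.

Definition kernel_map (a : arrow Q) (x : kernel (i (src a))) :
  kernel (i (tgt a)) := Sub (rep_map A a (val x)) (kernel_map_subproof x).

Lemma kernel_map_is_linear (a : arrow Q) : linear (@kernel_map a).
Proof. by move=> c x y; apply: val_inj; rewrite /= !linearP. Qed.

HB.instance Definition _ (a : arrow Q) :=
  GRing.isLinear.Build R (kernel (i (src a))) (kernel (i (tgt a))) *:%R
    (@kernel_map a) (@kernel_map_is_linear a).

Definition kernel_rep : representation Q R :=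
  Representation (rep_obj := fun v => kernel (i v) : lmodType R)
    (fun a => @kernel_map a : {linear _ -> _}).

Definition kernel_incl : rep_hom kernel_rep A :=
  @RepHom Q R kernel_rep A
    (fun v => (val : kernel (i v) -> A v) : {linear kernel (i v) -> A v})
    (fun a x => erefl).

Definition kernel_zero : rep_hom kernel_rep A :=
  @RepHom Q R kernel_rep A
    (fun v => \0 : {linear kernel (i v) -> A v})
    (fun a x => esym (linear0 (rep_map A a))).

(** A monomorphism cannot distinguish the inclusion of its kernel from zero. *)
Lemma rep_mono_injective : rep_mono i -> forall v, injective (i v).
Proof.
move=> mono v; apply: raddf_inj => x ix0.
have kx : x \in kernel_pred (i v) by rewrite inE ix0.
apply: (mono kernel_rep kernel_incl kernel_zero _ v (Sub x kx)) => w y /=.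
by rewrite kernelP linear0.
Qed.

End KernelRepresentation.

Lemma injective_rep_mono A B (i : rep_hom A B) :
  (forall v, injective (i v)) -> rep_mono i.
Proof. by move=> inj_i Z g h eq_gh v x; apply: (inj_i v); exact: eq_gh. Qed.

(** * From vertexwise conditions to injectivity *)

(** The equation along which [out_map] transports is given by an opaque proof;
    proof irrelevance replaces it by reflexivity. *)
Lemma out_mapE X (a : arrow Q) :
  out_map X (exist (fun b => src b = src a) a erefl) = rep_map X a.
Proof.
by rewrite /out_map; move: (svalP _) => /= e; rewrite (Prop_irrelevance e erefl).
Qed.

Lemma out_map_natural A X (f : rep_hom A X) v (a : out_arrow v) (x : A v) :
  f (tgt (sval a)) (out_map A a x) = out_map X a (f v x).
Proof.
case: a x => a e; case: _ / e => x.
by rewrite !out_mapE; exact: rep_hom_natural.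
Qed.

Section Extension.
Variables (X A B : representation Q R) (i : rep_hom A B) (f : rep_hom A X).
Hypothesis wfQ : well_founded (@successor Q).
Variable e : forall v, {linear B v -> X v}.
Hypothesis eK : forall v, e v \o i v =1 f v.
Variable s : forall v, {linear out_product X v -> X v}.
Hypothesis sK : forall v, source_map X v \o s v =1 id.

Definition prescribed_source v
    (g : forall w, successor w v -> {linear B w -> X w}) :
    {linear B v -> out_product X v} :=
  prodm_map (fun a : out_arrow v =>
    g (tgt (sval a)) (successor_out a) \o out_map B a : {linear _ -> _}).

Definition extension_step v
    (g : forall w, successor w v -> {linear B w -> X w}) :
    {linear B v -> X v} :=
  e v \+ (s v \o (prescribed_source g \- (source_map X v \o e v))).

Definition extension : forall v, {linear B v -> X v} :=
  Fix wfQ (fun v => {linear B v -> X v}) extension_step.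

Lemma extensionE v : extension v = extension_step (fun w _ => extension w).
Proof.
rewrite /extension Fix_eq // => w g h eq_gh; congr extension_step.
by apply: functional_extensionality_dep => u;
   apply: functional_extensionality_dep => lt_uw.
Qed.

Lemma source_extension v (b : B v) (a : out_arrow v) :
  out_map X a (extension v b) = extension (tgt (sval a)) (out_map B a b).
Proof.
rewrite extensionE -[LHS]/(source_map X v _ a) /= linearD.
have /= -> := sK (prescribed_source (fun w _ => extension w) b
                  - source_map X v (e v b)).
by rewrite addrC subrK.
Qed.

Lemma extension_natural (a : arrow Q) :
  extension (tgt a) \o rep_map B a =1 rep_map X a \o extension (src a).
Proof.
move=> b; pose a' : out_arrow (src a) := exist _ a erefl.
by have := source_extension b a'; rewrite !out_mapE.
Qed.

Lemma extension_extends v : extension v \o i v =1 f v.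
Proof.
elim/(well_founded_ind wfQ): v => v IH x.
rewrite extensionE /= -[e v (i v x)]/((e v \o i v) x) eK.
rewrite [X in s v X](_ : _ = 0) ?linear0 ?addr0 //.
apply/eqP; rewrite subr_eq0; apply/eqP.
apply: functional_extensionality_dep => a; rewrite /= /prodm_map /=.
rewrite -(out_map_natural i) -(out_map_natural f).
exact: IH _ (successor_out a) _.
Qed.

End Extension.

Lemma injective_rep_of_split X : well_founded (@successor Q) ->
  (forall v, injective_module (X v)) -> (forall v, split_epi (source_map X v)) ->
  injective_rep X.
Proof.
move=> wfQ injX splitX A B i f /rep_mono_injective inj_i.
pose e v := cid (injX v _ _ (i v) (f v) (inj_i v)).
pose s v := cid (splitX v).
exists (RepHom (extension_natural wfQ (fun v => sval (e v))
                  (fun v => svalP (s v)))) => v x.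
exact: extension_extends (fun v => svalP (e v)) _ _ x.
Qed.

(** * Splitting of the source maps of an injective representation *)

Section SourceCover.
Variable X : representation Q R.

Definition graph_of_source v : X v -> (X v * out_product X v)%type :=
  fun x => (x, source_map X v x).

Lemma graph_of_source_is_linear v : linear (@graph_of_source v).
Proof. by move=> c x y; rewrite /graph_of_source linearP. Qed.

HB.instance Definition _ v :=
  GRing.isLinear.Build R (X v) (X v * out_product X v)%type *:%R
    (@graph_of_source v) (@graph_of_source_is_linear v).

Definition cover_map (a : arrow Q) :
    (X (src a) * out_product X (src a))%type
    -> (X (tgt a) * out_product X (tgt a))%type :=
  fun z => graph_of_source (z.2 (exist _ a erefl)).

Lemma cover_map_is_linear (a : arrow Q) : linear (@cover_map a).
Proof. by move=> c x y; rewrite /cover_map -linearP. Qed.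

HB.instance Definition _ (a : arrow Q) :=
  GRing.isLinear.Build R
    (X (src a) * out_product X (src a))%type
    (X (tgt a) * out_product X (tgt a))%type
    *:%R (@cover_map a) (@cover_map_is_linear a).

(** An enlargement of [X] in which the values along the arrows leaving a vertex
    can be chosen freely: arrows read the second component only. *)
Definition source_cover : representation Q R :=
  Representation
    (rep_obj := fun v => (X v * out_product X v)%type : lmodType R)
    (fun a => @cover_map a : {linear _ -> _}).

Lemma graph_of_source_natural (a : arrow Q) :
  @graph_of_source (tgt a) \o rep_map X a
    =1 @cover_map a \o @graph_of_source (src a).
Proof. by move=> x; rewrite /= /cover_map /= /prodm_map out_mapE. Qed.

Definition cover_incl : rep_hom X source_cover :=
  @RepHom Q R X source_cover
    (fun v => @graph_of_source v : {linear _ -> _}) graph_of_source_natural.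

Definition rep_id : rep_hom X X :=
  @RepHom Q R X X (fun v => idfun : {linear X v -> X v}) (fun a x => erefl).

Lemma split_epi_source_map : injective_rep X -> forall v, split_epi (source_map X v).
Proof.
move=> injX v.
have [|r rK] := injX X source_cover cover_incl rep_id.
  by apply: injective_rep_mono => w x y [].
pose s (y : out_product X v) : X v := r v (0, y).
have s_lin : linear s.
  move=> c y z; rewrite /s -linearP; congr (r v _).
  by congr pair; rewrite /= scaler0 addr0.
pose sL := GRing.isLinear.Build _ _ _ _ s s_lin.
pose S : {linear _ -> _} := HB.pack s sL.
exists S => y; apply: functional_extensionality_dep => a.
rewrite /= /prodm_map /S /= /s {S sL s_lin s}.
case: a y => a ev; case: _ / ev => y; rewrite out_mapE.
have /= <- := rep_hom_natural r a (0, y).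
exact: rK.
Qed.

End SourceCover.

(** * Injectivity at the vertices of an injective representation *)

Section ZeroArrows.
Variables (A B : lmodType R) (i : {linear A -> B}).

Definition zero_arrow_rep (M : lmodType R) : representation Q R :=
  Representation (rep_obj := fun _ => M) (fun=> \0 : {linear M -> M}).

Definition zero_arrow_hom : rep_hom (zero_arrow_rep A) (zero_arrow_rep B) :=
  @RepHom Q R (zero_arrow_rep A) (zero_arrow_rep B) (fun _ => i)
    (fun a x => linear0 i).

Definition at_vertex X v (f : {linear A -> X v}) w : {linear A -> X w} :=
  if pselect (v = w) is left e then
    eq_rect v (fun u => {linear A -> X u}) f w e
  else \0.

Lemma at_vertex_self X v (f : {linear A -> X v}) : at_vertex f v = f.
Proof.
rewrite /at_vertex; case: pselect => // e.
by rewrite (Prop_irrelevance e erefl).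
Qed.

Lemma at_vertex_killed X v (f : {linear A -> X v}) :
    (forall x, source_map X v (f x) = 0) ->
  forall (a : arrow Q) x, rep_map X a (at_vertex f (src a) x) = 0.
Proof.
move=> f0 a x; rewrite /at_vertex; case: pselect => [e|_]; last exact: linear0.
subst v; rewrite /=.
rewrite -out_mapE; exact: (congr1 (fun h => h (exist _ a erefl)) (f0 x)).
Qed.

(** A homomorphism killed by the source map is the component at [v] of a morphism
    from a representation with zero arrows, namely the one given by
    [at_vertex]; the component at [v] of an extension of this morphism is the
    required one. *)
Lemma extend_into_source_kernel X v (f : {linear A -> X v}) :
    injective_rep X -> injective i -> (forall x, source_map X v (f x) = 0) ->
  exists g : {linear B -> X v}, g \o i =1 f.
Proof.
move=> injX inj_i f0.
have nat (a : arrow Q) :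
    at_vertex f (tgt a) \o rep_map (zero_arrow_rep A) a
      =1 rep_map X a \o at_vertex f (src a).
  by move=> x /=; rewrite at_vertex_killed // linear0.
have [|g gK] := injX _ _ zero_arrow_hom (@RepHom Q R (zero_arrow_rep A) X _ nat).
  by apply: injective_rep_mono => w.
by exists (g v) => x; have /= := gK v x; rewrite at_vertex_self.
Qed.

End ZeroArrows.

Lemma injective_prod_module (I : Type) (M : I -> lmodType R) :
  (forall k, injective_module (M k)) -> injective_module (prod_module M).
Proof.
move=> injM A B i f inj_i.
have ex k : {g : {linear B -> M k} | forall x, g (i x) = f x k}.
  apply: cid.
  have fk_lin : linear (fun x => f x k) by move=> c x y; rewrite linearP.
  pose fkL := GRing.isLinear.Build _ _ _ _ (fun x => f x k) fk_lin.
  pose fk : {linear A -> M k} := HB.pack (fun x => f x k) fkL.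
  exact: (injM k A B i fk inj_i).
exists (prodm_map (fun k => sval (ex k))) => x.
by apply: functional_extensionality_dep => k; exact: (svalP (ex k)).
Qed.

(** A homomorphism [f] into [X v] is the sum of [s p f], which factors through
    the product over the outgoing arrows, and of [f - s p f], which lands in the
    kernel of the source map [p]. *)
Lemma injective_vertex X : well_founded (@successor Q) -> injective_rep X ->
  forall v, injective_module (X v).
Proof.
move=> wfQ injX; elim/(well_founded_ind wfQ) => v IH A B i f inj_i.
have [s sK] := split_epi_source_map injX v.
have injP := injective_prod_module (fun a => IH _ (@successor_out Q v a)).
have [h hK] := injP A B i (source_map X v \o f : {linear _ -> _}) inj_i.
pose k : {linear A -> X v} := f \- (s \o (source_map X v \o f)).
have k0 x : source_map X v (k x) = 0.
  rewrite /k /= linearB; have /= -> := sK (source_map X v (f x)).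
  by rewrite subrr.
have [g gK] := extend_into_source_kernel injX inj_i k0.
exists ((s \o h) \+ g : {linear _ -> _}) => x.
have /= hKx := hK x; have /= gKx := gK x.
by rewrite /= hKx gKx addrC subrK.
Qed.

End Representations.

Theorem theorem4p2 (Q : quiver) (hQ : right_rooted Q) :
  source_injective_representation_quiver Q.
Proof.
move=> R X; have wfQ := right_rooted_wf hQ; split=> [injX | [injX splitX]].
  by split; [exact: injective_vertex | exact: split_epi_source_map].
exact: injective_rep_of_split.
Qed.
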